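(* Suppose $n\ge 2$ and $C>0$ is a constant for which $$|u(x)-u(y)|\le C r^{1-n/p}\left(\int_{B_r(z_0)}|Du|^pdz\right)^{1/p}$$ holds for each $z_0\in\mathbb{R}^n$, $r>0$, $x,y\in B_r(z_0)$ and $u\in \mathcal{D}^{1,p}(\mathbb{R}^n)$. Let $C_*$ be the sharp constant for Morrey's inequality. Then $$C_*<C.$$
   Context: Throughout, $n<p<\infty$, and $B_r(z_0)$ is the open ball of radius $r$ centered at $z_0$. $\mathcal{D}^{1,p}(\mathbb{R}^n)$ is the space of $u\in L^1_{\mathrm{loc}}(\mathbb{R}^n)$ whose weak first-order partial derivatives all belong to $L^p(\mathbb{R}^n)$. Every such $u$ has a Hölder continuous representative and is always identified with it. Put $[u]_{C^{1-n/p}(\mathbb{R}^n)}:=\sup_{x\ne y}\frac{|u(x)-u(y)|}{|x-y|^{1-n/p}}$ and $\|Du\|_{L^p(\mathbb{R}^n)}:=\left(\int_{\mathbb{R}^n}|Du|^p\,dx\right)^{1/p}$. Morrey's inequality says there is a finite constant $K$ with $[u]_{C^{1-n/p}(\mathbb{R}^n)}\le K\|Du\|_{L^p(\mathbb{R}^n)}$ for all $u\in\mathcal{D}^{1,p}(\mathbb{R}^n)$; $C_*$ is the sharp (smallest) such constant. *)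

(* Defs.v *)
From HB Require Import structures.
From mathcomp Require Import all_boot all_order all_algebra.
From mathcomp Require Import all_classical all_reals all_analysis.

Set Implicit Arguments.
Unset Strict Implicit.
Unset Printing Implicit Defensive.

Import Order.TTheory GRing.Theory Num.Theory.
Import numFieldNormedType.Exports.

Local Open Scope classical_set_scope.
Local Open Scope ring_scope.

(* R^n is ['rV[R]_n]. The library provides its topology and its derivatives
   but neither a measurable structure nor Lebesgue measure. The sigma-algebra
   below, generated by the coordinates, is the Borel sigma-algebra. *)

Section measurable_rV.
Context {R : realType} (n : nat).

Let coord (i : 'I_n) (x : 'rV[R]_n) : measurableTypeR R := x ord0 i.

Let rV_set0 : g_sigma_preimage coord set0.
Proof. exact: sigma_algebra0. Qed.

Let rV_setC A : g_sigma_preimage coord A -> g_sigma_preimage coord (~` A).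
Proof. exact: sigma_algebraC. Qed.

Let rV_bigcup (F : _^nat) : (forall i, g_sigma_preimage coord (F i)) ->
  g_sigma_preimage coord (\bigcup_i (F i)).
Proof. exact: sigma_algebra_bigcup. Qed.

HB.instance Definition _ := @isMeasurable.Build default_measure_display
  'rV[R]_n (g_sigma_preimage coord) rV_set0 rV_setC rV_bigcup.

Lemma measurable_coord (i : 'I_n) :
  measurable_fun [set: 'rV[R]_n] (fun x => x ord0 i : measurableTypeR R).
Proof.
move=> _ Y mY; rewrite setTI; apply: sub_sigma_algebra => /=.
rewrite -bigcup_seq/=; exists i => /=; first by rewrite mem_index_enum.
by exists Y => //; rewrite setTI.
Qed.

Lemma measurable_fun_rVP d (T : measurableType d) (f : T -> 'rV[R]_n) :
  measurable_fun setT f <->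
  forall i, measurable_fun setT (fun x => f x ord0 i : measurableTypeR R).
Proof.
split=> [mf i|mf].
  exact: (measurableT_comp (measurable_coord i) mf).
have sub : g_sigma_preimage (fun i => coord i \o f) `<=` measurable.
  apply: smallest_sub; first exact: sigma_algebra_measurable.
  by rewrite -bigcup_seq; apply: bigcup_sub => i _ A [B mB <-]; exact: mf.
move=> _ A mA; apply: sub; rewrite g_sigma_preimage_comp.
by exists A.
Qed.

End measurable_rV.

(* Lebesgue measure on R^n, by recursion on n: the image of the product of
   Lebesgue measure on R and Lebesgue measure on R^n under the isomorphism
   R * R^n -> R^(n+1). *)

Section lebesgue_measure_rV.
Context {R : realType}.
Local Open Scope ereal_scope.

Definition consrV n (tx : measurableTypeR R * 'rV[R]_n) : 'rV[R]_n.+1 :=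
  row_mx tx.1%:M tx.2.

Definition unconsrV n (x : 'rV[R]_n.+1) : measurableTypeR R * 'rV[R]_n :=
  (x ord0 ord0, \row_i x ord0 (lift ord0 i)).

Lemma consrV0 n tx : @consrV n tx ord0 ord0 = tx.1.
Proof.
rewrite /consrV; have -> : ord0 = lshift n (ord0 : 'I_1) by exact: val_inj.
by apply: etrans (row_mxEl _ _ _ _) _; rewrite mxE.
Qed.

Lemma consrVS n tx i : @consrV n tx ord0 (lift ord0 i) = tx.2 ord0 i.
Proof.
rewrite /consrV; have -> : lift ord0 i = rshift 1 i by exact: val_inj.
exact: row_mxEr.
Qed.

Lemma consrVK n : cancel (@consrV n) (@unconsrV n).
Proof.
move=> [t x]; rewrite /unconsrV consrV0; congr pair.
by apply/rowP => i; rewrite mxE consrVS.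
Qed.

Lemma measurable_consrV n : measurable_fun setT (@consrV n).
Proof.
apply/measurable_fun_rVP => i; have [j ->|->] := unliftP ord0 i.
- under eq_fun do rewrite consrVS.
  exact: measurableT_comp (measurable_coord j) measurable_snd.
- under eq_fun do rewrite consrV0.
  exact: measurable_fst.
Qed.

Lemma measurable_unconsrV n : measurable_fun setT (@unconsrV n).
Proof.
apply: measurable_fun_pair; first exact: measurable_coord.
apply/measurable_fun_rVP => i; under eq_fun do rewrite mxE.
exact: measurable_coord.
Qed.

Section cons_measure.
Variables (n : nat) (m : {sigma_finite_measure set 'rV[R]_n -> \bar R}).

Definition cons_measure : set 'rV[R]_n.+1 -> \bar R :=
  pushforward (lebesgue_measure \x m) (@consrV n).

Let cons_measure0 : cons_measure set0 = 0.
Proof. by rewrite /cons_measure /pushforward preimage_set0 measure0. Qed.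

Let cons_measure_ge0 A : 0 <= cons_measure A.
Proof. by rewrite /cons_measure /pushforward measure_ge0. Qed.

Let cons_measure_sigma_additive : semi_sigma_additive cons_measure.
Proof.
have mc A : measurable A -> measurable (@consrV n @^-1` A).
  by move=> mA; rewrite -[X in measurable X]setTI; exact: measurable_consrV.
move=> F mF tF mUF; rewrite /cons_measure /pushforward preimage_bigcup.
apply: measure_semi_sigma_additive.
- by move=> k; exact: mc.
- apply/trivIsetP => /= i j _ _ ij; rewrite -preimage_setI.
  by move/trivIsetP : tF => /(_ _ _ _ _ ij) ->//; rewrite preimage_set0.
- by rewrite -preimage_bigcup; exact: mc.
Qed.

HB.instance Definition _ := isMeasure.Build _ _ _ cons_measure
  cons_measure0 cons_measure_ge0 cons_measure_sigma_additive.

Let cons_measure_sigma_finite : sigma_finite setT cons_measure.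
Proof.
have /sigma_finiteP[F [TF ndF Foo]] := sigma_finiteT (@lebesgue_measure R).
have /sigma_finiteP[G [TG ndG Goo]] := sigma_finiteT m.
exists (fun k => @unconsrV n @^-1` (F k `*` G k)).
  rewrite -preimage_bigcup -[LHS](preimage_setT (@unconsrV n)); congr (_ @^-1` _).
  rewrite -setXTT TF TG predeqE => -[x y]; split.
    move=> [/= [k _ Fkx] [l _ Gly]]; exists (maxn k l) => //; split.
    - by move: x Fkx; exact/subsetPset/ndF/leq_maxl.
    - by move: y Gly; exact/subsetPset/ndG/leq_maxr.
  by move=> [k _ []/= ? ?]; split; exists k.
move=> k; have [mF Fk] := Foo k; have [mG Gk] := Goo k; split.
  rewrite -[X in measurable X]setTI; apply: measurable_unconsrV => //.
  exact: measurableX.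
rewrite /cons_measure /pushforward -comp_preimage.
rewrite (_ : _ \o _ = id); last by apply/funext => tx; exact: consrVK.
by rewrite preimage_id product_measure1E// lte_mul_pinfty// ge0_fin_numE.
Qed.

HB.instance Definition _ := Measure_isSigmaFinite.Build _ _ _ cons_measure
  cons_measure_sigma_finite.

End cons_measure.

Fixpoint lebesgue_rV n : {sigma_finite_measure set 'rV[R]_n -> \bar R} :=
  match n with
  | 0 => \d_(0%R : 'rV[R]_0)
  | n'.+1 => cons_measure (lebesgue_rV n')
  end.

Lemma lebesgue_rV_box n (A : 'I_n -> set (measurableTypeR R)) :
  (forall i, measurable (A i)) ->
  lebesgue_rV n [set x | forall i, A i (x ord0 i)] =
  \prod_(i < n) lebesgue_measure (A i).
Proof.
elim: n A => [|n IH] A mA.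
  by rewrite big_ord0 /= diracE mem_set// => -[].
have mB : measurable [set x : 'rV[R]_n | forall i, A (lift ord0 i) (x ord0 i)].
  rewrite [X in measurable X](_ : _ = \bigcap_(i in [set: 'I_n])
      ((fun x : 'rV[R]_n => x ord0 i : measurableTypeR R) @^-1` A (lift ord0 i))).
    apply: fin_bigcap_measurable => // i _.
    by rewrite -[X in measurable X]setTI; exact: measurable_coord.
  by apply/seteqP; split=> x /= h i; [move=> _|]; exact: h.
rewrite big_ord_recl -IH// /= /cons_measure /pushforward.
rewrite -product_measure1E//.
congr (_ _); apply/seteqP; split => -[t x] /=.
  move=> h; split=> [|i]; [have := h ord0|have := h (lift ord0 i)];
    by rewrite ?consrV0 ?consrVS.
by move=> [ht hx] i; have [j ->|->] := unliftP ord0 i;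
  rewrite ?consrV0 ?consrVS.
Qed.

End lebesgue_measure_rV.

Section sobolev.
Context {R : realType} {n : nat}.
Implicit Types (u g phi : 'rV[R]_n -> R) (x y z : 'rV[R]_n) (i : 'I_n).

Local Notation mu := (@lebesgue_rV R n).

(* The norm of the library on ['rV[R]_n] is the sup norm, which is equivalent
   to, but different from, the Euclidean norm. *)
Definition enorm x : R := Num.sqrt (\sum_i x ord0 i ^+ 2).

Definition eball z (r : R) : set 'rV[R]_n := [set x | enorm (x - z) < r].

Definition partial i phi : 'rV[R]_n -> R := 'D_(delta_mx ord0 i) phi.

Definition iter_partial (s : seq 'I_n) phi : 'rV[R]_n -> R :=
  foldr partial phi s.

Definition smooth phi := forall s : seq 'I_n,
  continuous (iter_partial s phi) /\
  forall i x, derivable (iter_partial s phi) x (delta_mx ord0 i).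

Definition test_function phi :=
  smooth phi /\ compact (closure [set x | phi x != 0]).

Definition locally_integrable_rV u := measurable_fun setT u /\
  forall K : set 'rV[R]_n, compact K -> (\int[mu]_(x in K) `|u x|%:E < +oo)%E.

Definition is_weak_partial i u g := locally_integrable_rV g /\
  forall phi, test_function phi ->
    \int[mu]_x (u x * partial i phi x) = - \int[mu]_x (g x * phi x).

(* Weak partial derivatives are unique up to a null set, and only enter the
   statement through integrals: the choice made here is immaterial. *)
Definition weak_partial i u : 'rV[R]_n -> R :=
  xget (cst 0) [set g | is_weak_partial i u g].

Definition weak_grad u x : 'rV[R]_n := \row_i weak_partial i u x.

(* Continuity expresses that an element of D^{1,p}, p > n, is identified with
   its Hoelder continuous representative, which is its only continuous one. *)
Definition D1p (p : R) u := [/\ continuous u, locally_integrable_rV u &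
  forall i, exists2 g, is_weak_partial i u g & g \in Lfun mu p%:E].

Definition grad_norm (p : R) (D : set 'rV[R]_n) u : \bar R :=
  ((\int[mu]_(x in D) (enorm (weak_grad u x) `^ p)%:E) `^ p^-1)%E.

Definition holder_seminorm (a : R) u : \bar R :=
  ereal_sup [set t | exists x y,
    x != y /\ t = (`|u x - u y| / enorm (x - y) `^ a)%:E].

Definition morrey_inequality (p K : R) := forall u, D1p p u ->
  (holder_seminorm (1 - n%:R / p) u <= K%:E * grad_norm p setT u)%E.

End sobolev.

Definition sharp_morrey_constant {R : realType} (n : nat) (p K : R) :=
  morrey_inequality (n := n) p K /\
  forall K', morrey_inequality (n := n) p K' -> K <= K'.

(* Main.v *)
(** Two points [x != y] lie in the ball centred at their midpoint with radius
    [3/4 |x - y|] (any factor in ]1/2, 1[ would do). Since [1 - n/p > 0], the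
    local estimate on that ball yields Morrey's inequality with the constant
    [C (3/4)^(1 - n/p) < C]. *)
Require Import Defs.
From mathcomp Require Import all_boot all_order all_algebra.
From mathcomp Require Import all_classical all_reals all_analysis.
From mathcomp Require Import measurable_realfun ring lra.

Import Order.TTheory GRing.Theory Num.Theory.
Import numFieldNormedType.Exports.

Local Open Scope classical_set_scope.
Local Open Scope ring_scope.

Lemma enormZ (R : realType) (n : nat) (c : R) (x : 'rV[R]_n) :
  enorm (c *: x) = `|c| * enorm x.
Proof.
rewrite /enorm -sqrtr_sqr -sqrtrM ?sqr_ge0// mulr_sumr.
by congr Num.sqrt; apply: eq_bigr => i _; rewrite mxE exprMn.
Qed.

Lemma enorm_gt0 (R : realType) (n : nat) (x : 'rV[R]_n) :
  (0 < enorm x) = (x != 0).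
Proof.
rewrite /enorm sqrtr_gt0 lt_neqAle sumr_ge0 ?andbT; last first.
  by move=> i _; exact: sqr_ge0.
rewrite eq_sym psumr_eq0; last by move=> i _; exact: sqr_ge0.
congr negb; apply/allP/eqP => [x0|-> i _]; last by rewrite mxE expr0n /= eqxx.
apply/rowP => i; rewrite mxE; apply/eqP.
by have := x0 i (mem_index_enum i); rewrite sqrf_eq0.
Qed.

Lemma measurable_enorm (R : realType) (n : nat) d (T : measurableType d)
    (f : T -> 'rV[R]_n) :
  measurable_fun setT f -> measurable_fun setT (fun x => enorm (f x)).
Proof.
move=> /measurable_fun_rVP mf.
(* The square root becomes the power [2^-1], for which [measurable_powR] applies; the two agree
   because the sum of squares is nonnegative. *)
rewrite (_ : (fun _ => _) =
    (fun x => (\sum_i f x ord0 i ^+ 2) `^ 2^-1)); last first.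
  by apply/funext => x; rewrite powR12_sqrt// sumr_ge0// => i _; exact: sqr_ge0.
apply: (measurableT_comp (measurable_powR 2^-1)).
by apply: measurable_sum => i; apply: measurable_funX; exact: mf.
Qed.

(** The sigma-algebra is generated by the coordinates, so the ball is treated as the preimage of a
    half-line rather than through its openness. *)
Lemma measurable_eball (R : realType) (n : nat) (z : 'rV[R]_n) (r : R) :
  measurable (eball z r).
Proof.
have mf : measurable_fun setT (fun x : 'rV[R]_n => enorm (x - z)).
  apply: measurable_enorm; apply/measurable_fun_rVP => i.
  under eq_fun do rewrite !mxE.
  by apply: measurable_funB => //; exact: measurable_coord.
rewrite (_ : eball z r = (fun x => enorm (x - z)) @^-1` [set` `]-oo, r[]).
  by rewrite -[X in measurable X]setTI; apply: mf => //; exact: measurable_itv.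
by apply/seteqP; split => x /=; rewrite in_itv.
Qed.

Lemma measurable_weak_grad (R : realType) (n : nat) (p : R)
    (u : 'rV[R]_n -> R) :
  D1p p u -> measurable_fun setT (weak_grad u).
Proof.
move=> [_ _ Du]; apply/measurable_fun_rVP => i; under eq_fun do rewrite mxE.
have [g gu _] := Du i; rewrite /weak_partial.
(* The witness [g] excludes the default value of [xget], so the chosen function is a weak partial
   derivative, hence locally integrable and in particular measurable. *)
by case: xgetP => [_ _ [[]]//|/(_ g)].
Qed.

Lemma le_grad_norm (R : realType) (n : nat) (p : R) (u : 'rV[R]_n -> R)
    (A B : set 'rV[R]_n) :
  0 <= p -> D1p p u -> measurable A -> measurable B -> A `<=` B ->
  (grad_norm p A u <= grad_norm p B u)%E.
Proof.
move=> p0 uD mA mB AB; have pow_ge0 x : (0 <= (enorm (weak_grad u x) `^ p)%:E)%E.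
  by rewrite lee_fin powR_ge0.
(* The outer power is monotone because [p^-1] is nonnegative; this leaves monotonicity in the domain
   of the integral of a nonnegative measurable function. *)
apply: gt0_ler_poweR; rewrite ?invr_ge0 ?in_itv//= ?leey ?andbT ?integral_ge0//.
apply: ge0_subset_integral => //; apply: measurable_funTS; apply/measurable_EFinP.
apply: (measurableT_comp (measurable_powR p)).
by apply: measurable_enorm; exact: (measurable_weak_grad _ _ _ _ uD).
Qed.

(** Each point differs from the midpoint by half of [x - y], up to sign. *)
Lemma mem_eball_midpoint (R : realType) (n : nat) (x y : 'rV[R]_n) (r : R) :
  enorm (x - y) < 2 * r ->
  eball (2^-1 *: (x + y)) r x /\ eball (2^-1 *: (x + y)) r y.
Proof.
move=> xyr; rewrite /eball /=.
have -> : x - 2^-1 *: (x + y) = 2^-1 *: (x - y).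
  by apply/rowP => i; rewrite !mxE; lra.
have -> : y - 2^-1 *: (x + y) = (- 2^-1) *: (x - y).
  by apply/rowP => i; rewrite !mxE; lra.
by rewrite !enormZ normrN ger0_norm ?invr_ge0//; split; lra.
Qed.

Lemma morrey_inequality_local (R : realType) (n : nat) (p C : R) :
  0 <= p -> 0 <= C ->
  (forall (z0 : 'rV[R]_n) (r : R) (x y : 'rV[R]_n) (u : 'rV[R]_n -> R),
    0 < r -> eball z0 r x -> eball z0 r y -> D1p p u ->
    (`|u x - u y|%:E <=
      (C * r `^ (1 - n%:R / p))%:E * grad_norm p (eball z0 r) u)%E) ->
  forall s : R, 2^-1 < s ->
  morrey_inequality (n := n) p (C * s `^ (1 - n%:R / p)).
Proof.
move=> p0 C0 local s s2 u uD; apply: ge_ereal_sup => _ [x [y [xy ->]]].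
have s0 : 0 < s by apply: lt_trans s2; rewrite invr_gt0.
set a := 1 - _; set d := enorm (x - y).
have d0 : 0 < d by rewrite enorm_gt0 subr_eq0.
have [xB yB] : eball (2^-1 *: (x + y)) (s * d) x /\
    eball (2^-1 *: (x + y)) (s * d) y.
  (* The strict bound [2^-1 < s] gives [d < 2 * (s * d)], as the open ball requires. *)
  by apply: mem_eball_midpoint; rewrite -/d; nra.
have := local _ _ _ _ _ (mulr_gt0 s0 d0) xB yB uD.
(* The power of the radius [s * d] splits: the factor from [d] is the Hölder denominator, and the
   factor from [s] joins the constant. *)
rewrite -/a powRM ?(ltW s0) ?(ltW d0)// mulrA mulrC => /le_trans xyG.
rewrite mulrC EFinM lee_pdivrMl ?powR_gt0// muleA -EFinM; apply: xyG.
apply: lee_wpmul2l; first by rewrite lee_fin !mulr_ge0 ?powR_ge0.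
by apply: le_grad_norm => //; exact: measurable_eball.
Qed.

Theorem proposition5p1 (R : realType) (n : nat) (p C Cstar : R) :
  (2 <= n)%N -> n%:R < p -> 0 < C ->
  (forall (z0 : 'rV[R]_n) (r : R) (x y : 'rV[R]_n) (u : 'rV[R]_n -> R),
    0 < r -> eball z0 r x -> eball z0 r y -> D1p p u ->
    (`|u x - u y|%:E <=
      (C * r `^ (1 - n%:R / p))%:E * grad_norm p (eball z0 r) u)%E) ->
  sharp_morrey_constant n p Cstar ->
  Cstar < C.
Proof.
move=> _ np C0 local [_ Cstar_min].
have p0 : 0 < p by apply: le_lt_trans np.
have a0 : 0 < 1 - n%:R / p by rewrite subr_gt0 ltr_pdivrMr// mul1r.
have s2 : 2^-1 < 3 / 4 :> R by lra.
have := morrey_inequality_local _ _ _ _ (ltW p0) (ltW C0) local _ s2.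
move=> /Cstar_min/le_lt_trans; apply.
(* Strictness comes from here: the exponent is positive as [n%:R < p], so the power is strictly
   increasing. *)
have : (3 / 4) `^ (1 - n%:R / p) < 1 `^ (1 - n%:R / p).
  by apply: gt0_ltr_powR => //; rewrite ?nnegrE; lra.
by rewrite powR1 -(ltr_pM2l C0) mulr1.
Qed.
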